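(* Let $G$ be a bicoloured graph and let $s,t\in W^\circ(G)$ be reduced parity words with $V(s)=V(t)$. Then $Gs=Gt$.
   Context: A bicoloured graph is a simple graph whose vertices are coloured black or white. For bicoloured $G$ and $u\in V(G)$, $Gu$ has edge set $E(G)\triangle\{[x,y]:x\ne y\in N_G(u)\}$ and the same colouring if $u$ is black, while if $u$ is white the colours of all vertices of $N_G(u)$ are reversed; for a word $s=u_1\cdots u_k$, $Gs=(\cdots(Gu_1)\cdots)u_k$. $W^\circ(G)$ (parity words) is the smallest set of words over $V(G)$ containing the empty word such that $s\in W^\circ(G)$, $u$ white in $Gs$ implies $su\in W^\circ(G)$, and $s\in W^\circ(G)$, $u,v$ adjacent black in $Gs$ implies $suvu,svuv\in W^\circ(G)$. $V(s)$ denotes the set of letters occurring in $s$. A word $s$ is reduced (w.r.t. $G$) if $s=s_1\cdots s_n$ where the letter sets of the blocks $s_i$ are pairwise disjoint and each $s_i$ is either a single vertex or a word $uvu$ with $[u,v]\in E(Gs_1\cdots s_{i-1})$. *)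

(* Defs.v *)
From mathcomp Require Import all_boot.

Set Implicit Arguments.
Unset Strict Implicit.
Unset Printing Implicit Defensive.

(* The vertex set is not required to be finite: finite graphs are the
   instances where [V] is a finType. *)
Record bgraph (V : eqType) := BGraph {
  edge : rel V;
  white : pred V;
  edge_sym : symmetric edge;
  edge_irr : irreflexive edge
}.

(* Symmetric difference of E(G) with the pairs of distinct neighbours of u. *)
Definition loc_edge (V : eqType) (G : bgraph V) (u : V) : rel V :=
  fun x y => edge G x y (+) [&& x != y, edge G u x & edge G u y].

Definition loc_white (V : eqType) (G : bgraph V) (u : V) : pred V :=
  fun x => if white G u then white G x (+) edge G u x else white G x.

Lemma loc_edge_sym (V : eqType) (G : bgraph V) (u : V) : symmetric (loc_edge G u).
Proof.
move=> x y; rewrite /loc_edge (edge_sym G x y) (eq_sym x y).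
by rewrite (andbC (edge G u x)).
Qed.

Lemma loc_edge_irr (V : eqType) (G : bgraph V) (u : V) : irreflexive (loc_edge G u).
Proof. by move=> x; rewrite /loc_edge edge_irr eqxx. Qed.

Definition local (V : eqType) (G : bgraph V) (u : V) : bgraph V :=
  BGraph (loc_white G u) (loc_edge_sym G u) (loc_edge_irr G u).

(* Gs: the letters of s act from left to right. *)
Definition act (V : eqType) (G : bgraph V) (s : seq V) : bgraph V :=
  foldl (@local V) G s.

Inductive parity_word (V : eqType) (G : bgraph V) : seq V -> Prop :=
| parity_nil : parity_word G [::]
| parity_white s u :
    parity_word G s -> white (act G s) u -> parity_word G (s ++ [:: u])
| parity_black_uvu s u v :
    parity_word G s -> edge (act G s) u v ->
    ~~ white (act G s) u -> ~~ white (act G s) v ->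
    parity_word G (s ++ [:: u; v; u])
| parity_black_vuv s u v :
    parity_word G s -> edge (act G s) u v ->
    ~~ white (act G s) u -> ~~ white (act G s) v ->
    parity_word G (s ++ [:: v; u; v]).

Definition disjoint_letters (V : eqType) (a b : seq V) : bool :=
  ~~ has (mem a) b.

Definition reduced_block (V : eqType) (G : bgraph V) (b : seq V) : Prop :=
  (exists u, b = [:: u]) \/ (exists u v, edge G u v /\ b = [:: u; v; u]).

(* [bs] lists the blocks s_1, ..., s_n (numbered from 0). *)
Definition reduced (V : eqType) (G : bgraph V) (s : seq V) : Prop :=
  exists bs : seq (seq V),
    [/\ s = flatten bs,
        pairwise (@disjoint_letters V) bs
      & forall i, i < size bs ->
          reduced_block (act G (flatten (take i bs))) (nth [::] bs i)].

(* Main.v *)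
Require Import Defs.
From mathcomp Require Import all_boot.
From Stdlib Require Import FunctionalExtensionality.

Set Implicit Arguments.
Unset Strict Implicit.
Unset Printing Implicit Defensive.

(** Read a bicoloured graph as a symmetric matrix over GF(2) with a diagonal 1
    at each white vertex.  Local complementation at a white vertex, and [uvu] at
    a black edge [uv], are principal pivots on [u], resp. [u, v]: they exchange
    the corresponding entries of [x] and [y] in the relation [y = A x].  The
    blocks of a reduced parity word are exactly such steps and have disjoint
    letters, so [Gs] is the principal pivot of [G] on [V(s)], and the relation
    [y = A x] determines [A]. *)

(** * Bicoloured graphs as matrices over GF(2) *)

Definition adj (V : eqType) (G : bgraph V) (x y : V) : bool :=
  edge G x y (+) ((x == y) && white G x).

(* Restricting to a finite list [L] of vertices makes the product a finite sum
   even when [V] is infinite. *)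
Definition is_image (V : eqType) (L : seq V) (G : bgraph V) (x y : V -> bool) :=
  forall v, v \in L -> y v = \big[addb/false]_(w <- L) (adj G v w && x w).

Definition exchange (V : eqType) (s : seq V) (x y : V -> bool) (v : V) : bool :=
  if v \in s then y v else x v.

(** Principal pivoting as a relation: no block has to be inverted, and successive pivots compose by
    chaining equivalences. *)
Definition pivots (V : eqType) (L : seq V) (G : bgraph V) (s : seq V)
    (H : bgraph V) : Prop :=
  forall x y, is_image L G x y <-> is_image L H (exchange s x y) (exchange s y x).

(** As there are no loops, off-diagonal entries give the edges and diagonal ones the colours; the
    two proof fields are Boolean equalities, hence irrelevant. *)
Lemma bgraph_ext (V : eqType) (G H : bgraph V) :
  (forall x y, adj G x y = adj H x y) -> G = H.
Proof.
case: G H => [e c es ei] [e' c' es' ei'] eqA.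
have eqe : e = e'.
  apply: functional_extensionality => x; apply: functional_extensionality => y.
  have := eqA x y; rewrite /adj /=; case: eqP => [->|_]; last by rewrite !addbF.
  by rewrite ei ei'.
have eqc : c = c'.
  apply: functional_extensionality => x.
  by have := eqA x x; rewrite /adj /= ei ei' eqxx.
subst e' c'; congr BGraph.
  do 2!apply: functional_extensionality_dep => ?; exact: eq_irrelevance.
apply: functional_extensionality_dep => ?; exact: eq_irrelevance.
Qed.

(** * Effect of the two moves on matrix entries *)

(** The diagonal entry at [u] is 1, so off row and column [u] this is the Schur complement; its
    diagonal terms are the colour flips. Row and column [u] are kept, signs being invisible mod
    2. *)
Lemma adj_local_white (V : eqType) (G : bgraph V) (u x y : V) : white G u ->
  adj (local G u) x y =
    adj G x y (+) [&& x != u, y != u, adj G x u & adj G u y].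
Proof.
move=> wu; rewrite /adj /= /loc_edge /loc_white wu (eq_sym u y).
have [->|xu] := eqVneq x u; first by rewrite edge_irr /= andbF !addbF.
have [->|yu] := eqVneq y u; first by rewrite edge_irr (negPf xu) !andbF !addbF.
rewrite /= !addbF (edge_sym G x u).
have [->|xy] := eqVneq x y; last by rewrite /= !addbF.
by rewrite edge_irr andbb.
Qed.

(** The block on [u], [v] has diagonal 0 and off-diagonal 1, so it is its own inverse: outside it
    the rows and columns of [u] and [v] are swapped, and the rest is the Schur complement. *)
Lemma adj_local_black_edge (V : eqType) (G : bgraph V) (u v x y : V) :
  edge G u v -> ~~ white G u -> ~~ white G v ->
  adj (act G [:: u; v; u]) x y =
    if x == u then (if y == u then false else if y == v then true else adj G v y)
    else if x == v then
      (if y == v then false else if y == u then true else adj G u y)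
    else if y == u then adj G x v else if y == v then adj G x u
    else adj G x y (+) (adj G x u && adj G v y) (+) (adj G x v && adj G u y).
Proof.
move=> uv /negPf bu /negPf bv.
have vu : edge G v u by rewrite edge_sym.
have nuv : u == v = false by apply/eqP => e; rewrite e edge_irr in uv.
have nvu : v == u = false by rewrite eq_sym.
have e0 a : edge G a a = false by exact: edge_irr.
rewrite /adj; cbn [act foldl local edge white].
rewrite /loc_edge; cbn [local edge white]; rewrite /loc_edge.
rewrite /loc_white; cbn [local edge white]; rewrite /loc_white.
cbn [local edge white]; rewrite /loc_white /loc_edge.
rewrite !(bu, bv).
have [->|xu] := eqVneq x u.
  have [->|yu] := eqVneq y u.
    by rewrite ?(eqxx, bu, bv, e0, uv, vu, nuv, nvu) /=.
  have [->|yv] := eqVneq y v.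
    by rewrite ?(eqxx, bu, bv, e0, uv, vu, nuv, nvu) /=.
  have [uy vy] : u == y = false /\ v == y = false.
    by rewrite !(eq_sym _ y) (negPf yu) (negPf yv).
  rewrite ?(eqxx, bu, bv, e0, uv, vu, nuv, nvu, uy, vy) /=.
  by case: (edge G u y); case: (edge G v y).
have [->|xv] := eqVneq x v.
  have [->|yv] := eqVneq y v.
    by rewrite ?(eqxx, bu, bv, e0, uv, vu, nuv, nvu) /=.
  have [->|yu] := eqVneq y u.
    by rewrite ?(eqxx, bu, bv, e0, uv, vu, nuv, nvu) /=.
  have [uy vy] : u == y = false /\ v == y = false.
    by rewrite !(eq_sym _ y) (negPf yu) (negPf yv).
  rewrite ?(eqxx, bu, bv, e0, uv, vu, nuv, nvu, uy, vy) /=.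
  by case: (edge G u y); case: (edge G v y).
have [ux vx] : u == x = false /\ v == x = false.
  by rewrite !(eq_sym _ x) (negPf xu) (negPf xv).
have [->|yu] := eqVneq y u.
  rewrite ?(eqxx, bu, bv, e0, uv, vu, nuv, nvu, ux, vx, negPf xu, negPf xv) /=.
  by rewrite ?(edge_sym G x); case: (edge G u x); case: (edge G v x).
have [->|yv] := eqVneq y v.
  rewrite ?(eqxx, bu, bv, e0, uv, vu, nuv, nvu, ux, vx, negPf xu, negPf xv) /=.
  by rewrite ?(edge_sym G x); case: (edge G u x); case: (edge G v x).
have [uy vy] : u == y = false /\ v == y = false.
  by rewrite !(eq_sym _ y) (negPf yu) (negPf yv).
rewrite ?(eqxx, bu, bv, e0, uv, vu, nuv, nvu, ux, vx, uy, vy, negPf xu, negPf xv) /=.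
rewrite (edge_sym G x u) (edge_sym G x v).
(* On the diagonal the two products coincide and cancel: the colour stays. *)
have [->|xy] := eqVneq x y; rewrite ?e0 /=.
  by case: (edge G u y); case: (edge G v y); case: (white G y).
by case: (edge G u x); case: (edge G v x);
   case: (edge G u y); case: (edge G v y); case: (edge G x y).
Qed.

(** * The two moves as principal pivots *)

Lemma pivots_white (V : eqType) (L : seq V) (G : bgraph V) (u : V) :
  uniq L -> u \in L -> white G u -> pivots L G [:: u] (act G [:: u]).
Proof.
move=> uL Lu wu x y.
(* [S v] collects the columns that the exchange leaves alone. *)
pose S v := \big[addb/false]_(w <- L | w != u) (adj G v w && x w).
have auu : adj G u u by rewrite /adj edge_irr eqxx wu.
have sumG v : \big[addb/false]_(w <- L) (adj G v w && x w) =
    (adj G v u && x u) (+) S v.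
  by rewrite (bigD1_seq u).
have sumH v :
    \big[addb/false]_(w <- L) (adj (local G u) v w && exchange [:: u] x y w) =
    (adj G v u && y u) (+) S v (+) ((v != u) && (adj G v u && S u)).
  rewrite (bigD1_seq u) //= -addbA; congr (_ (+) _).
    by rewrite adj_local_white // eqxx andbF addbF /exchange mem_head.
  rewrite /S !big_distrr -big_split; apply: eq_bigr => w wNu /=.
  rewrite adj_local_white // wNu /exchange inE (negPf wNu) /=.
  by case: (v != u); case: (adj G v w); case: (adj G v u); case: (adj G u w);
     case: (x w).
(* Row [u] amounts to [y u = x u + S u] on both sides; it trades [x u] for [y u] in every other
   row. *)
rewrite /is_image [act _ _]/=; split=> E v Lv; have := E v Lv; have := E u Lu;
  rewrite !(sumG, sumH) /exchange !inE ?eqxx auu /=;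
  have [->|_] := eqVneq v u; rewrite ?auu /=;
  by case: (adj G v u); case: (x u); case: (y u); case: (S u);
     case: (y v); case: (S v).
Qed.

Lemma pivots_black_edge (V : eqType) (L : seq V) (G : bgraph V) (u v : V) :
    uniq L -> u \in L -> v \in L ->
    edge G u v -> ~~ white G u -> ~~ white G v ->
  pivots L G [:: u; v; u] (act G [:: u; v; u]).
Proof.
move=> uL Lu Lv uv bu bv x y.
have vNu : v != u by apply/eqP => e; rewrite e edge_irr in uv.
have uNv : u != v by rewrite eq_sym.
pose S z := \big[addb/false]_(w <- L | (w != u) && (w != v)) (adj G z w && x w).
have split2 F : \big[addb/false]_(w <- L) F w =
    F u (+) (F v (+) \big[addb/false]_(w <- L | (w != u) && (w != v)) F w).
  rewrite (bigD1_seq u) //= -big_filter (bigD1_seq v) ?filter_uniq //; last first.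
    by rewrite mem_filter vNu.
  by rewrite big_filter_cond.
have auu : adj G u u = false by rewrite /adj edge_irr eqxx (negPf bu).
have avv : adj G v v = false by rewrite /adj edge_irr eqxx (negPf bv).
have auv : adj G u v by rewrite /adj uv (negPf uNv).
have avu : adj G v u by rewrite /adj edge_sym uv (negPf vNu).
have exu a b : exchange [:: u; v; u] a b u = b u by rewrite /exchange mem_head.
have exv a b : exchange [:: u; v; u] a b v = b v.
  by rewrite /exchange !inE eqxx orbT.
have exN a b w : w != u -> w != v -> exchange [:: u; v; u] a b w = a w.
  by move=> /negPf wu /negPf wv; rewrite /exchange !inE wu wv.
have := fun z w => adj_local_black_edge z w uv bu bv.
move: (act G _) => H adjH.
have sumH z : \big[addb/false]_(w <- L)
      (adj H z w && exchange [:: u; v; u] x y w) =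
    if z == u then y v (+) S v else if z == v then y u (+) S u
    else (adj G z v && y u) (+) ((adj G z u && y v) (+)
      (S z (+) (adj G z u && S v) (+) (adj G z v && S u))).
  rewrite split2 exu exv !adjH !eqxx (negPf vNu) (negPf uNv).
  have [->|zNu] := eqVneq z u.
    rewrite /= /S; congr (_ (+) _); apply: eq_bigr => w /andP[wu wv].
    by rewrite adjH exN // eqxx (negPf wu) (negPf wv).
  have [->|zNv] := eqVneq z v.
    rewrite /= /S; congr (_ (+) _); apply: eq_bigr => w /andP[wu wv].
    by rewrite adjH exN // eqxx (negPf wu) (negPf wv) (negPf vNu).
  congr (_ (+) (_ (+) _)); rewrite /S !big_distrr -!big_split.
  apply: eq_bigr => w /andP[wu wv] /=; rewrite adjH exN //.
  rewrite !(negPf wu, negPf wv, negPf zNu, negPf zNv).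
  by case: (adj G z w); case: (adj G z u); case: (adj G z v);
     case: (adj G u w); case: (adj G v w); case: (x w).
have sumG z : \big[addb/false]_(w <- L) (adj G z w && x w) =
    (adj G z u && x u) (+) ((adj G z v && x v) (+) S z).
  exact: split2.
(* Rows [u] and [v] amount to [y u = x v + S u] and [y v = x u + S v]; they trade [x v] for [y u]
   and [x u] for [y v] in every other row. *)
rewrite /is_image; split=> E z Lz; have := E z Lz; have := E u Lu; have := E v Lv;
  rewrite !(sumG, sumH) ?(exu, exv) ?eqxx ?(negPf vNu) ?auu ?avv ?auv ?avu;
  (have [->|zNu] := eqVneq z u; first by
    rewrite ?exu ?auu ?auv;
    case: (x u); case: (x v); case: (y u); case: (y v); case: (S u); case: (S v));
  (have [->|zNv] := eqVneq z v; first by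
    rewrite ?exv ?avu ?avv;
    case: (x u); case: (x v); case: (y u); case: (y v); case: (S u); case: (S v));
  rewrite ?exN //;
  by case: (adj G z u); case: (adj G z v); case: (x u); case: (x v);
     case: (y u); case: (y v); case: (S u); case: (S v); case: (y z); case: (S z).
Qed.

(** * Composition and uniqueness of pivots *)

Lemma pivots_nil (V : eqType) (L : seq V) (G : bgraph V) : pivots L G [::] G.
Proof. by []. Qed.

(** A letter in both words would be exchanged twice and so restored; disjointness excludes this. *)
Lemma pivots_cat (V : eqType) (L : seq V) (G H K : bgraph V) (s t : seq V) :
  disjoint_letters s t -> pivots L G s H -> pivots L H t K ->
  pivots L G (s ++ t) K.
Proof.
move=> dst GH HK x y.
have exchange_cat a b :
    exchange t (exchange s a b) (exchange s b a) = exchange (s ++ t) a b.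
  apply: functional_extensionality => v; rewrite /exchange mem_cat.
  case: ifP => [vt|]; last by rewrite orbF.
  by rewrite orbT ifN //; apply: contra dst => vs; apply/hasP; exists v.
by rewrite -!exchange_cat; apply: iff_trans (GH x y) (HK _ _).
Qed.

(** The image of the indicator of [b] is column [b]. Undoing the pivot from [H] back to [G] and
    redoing it towards [K] returns the same pair of vectors, so the columns agree. *)
Lemma pivots_unique (V : eqType) (G H K : bgraph V) (s t : seq V) : s =i t ->
  (forall L, uniq L -> {subset s <= L} -> pivots L G s H) ->
  (forall L, uniq L -> {subset t <= L} -> pivots L G t K) ->
  H = K.
Proof.
move=> st GH GK; apply: bgraph_ext => a b.
(* [V] may be infinite, so [L] is chosen anew for each entry [a], [b]. *)
pose L := undup (a :: b :: s).
have uL : uniq L by exact: undup_uniq.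
have sL : {subset s <= L} by move=> z zs; rewrite mem_undup !inE zs !orbT.
have tL : {subset t <= L} by move=> z; rewrite -st; exact: sL.
have exchange_eq x y : exchange t x y = exchange s x y.
  by apply: functional_extensionality => v; rewrite /exchange st.
have exchangeK x y : exchange s (exchange s x y) (exchange s y x) = x.
  by apply: functional_extensionality => v; rewrite /exchange; case: (v \in s).
pose x w := w == b; pose y v := adj H v b.
have sumb M v : \big[addb/false]_(w <- L) (adj M v w && x w) = adj M v b.
  rewrite (bigD1_seq b) //=; last by rewrite mem_undup !inE eqxx orbT.
  rewrite /x eqxx andbT big1 ?addbF // => w /negPf ->; exact: andbF.
have imH : is_image L H x y by move=> v _; rewrite sumb.
have := GH L uL sL (exchange s x y) (exchange s y x); rewrite !exchangeK => -[_ hH].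
have := GK L uL tL (exchange s x y) (exchange s y x).
rewrite !exchange_eq !exchangeK => -[hK _].
by have := hK (hH imH) a; rewrite sumb; apply; rewrite mem_undup mem_head.
Qed.

(** * Blocks of reduced parity words *)

Lemma parity_word_inv (V : eqType) (G : bgraph V) (w : seq V) :
  parity_word G w ->
  [\/ w = [::],
      exists s u, [/\ w = s ++ [:: u], parity_word G s & white (act G s) u]
    | exists s u v, [/\ w = s ++ [:: u; v; u], parity_word G s,
        edge (act G s) u v, ~~ white (act G s) u & ~~ white (act G s) v]].
Proof.
case=> [|s u ps wu|s u v ps uv bu bv|s u v ps uv bu bv].
- by constructor 1.
- by constructor 2; exists s, u.
- by constructor 3; exists s, u, v.
- by constructor 3; exists s, v, u; split=> //; rewrite edge_sym.
Qed.

(* A block [uvu] at an edge cannot arise as three white letters: if [u] is white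
   and then [v] is white, acting with [v] turns [u] black. *)
Lemma parity_word_last_block (V : eqType) (G : bgraph V) (s b : seq V) :
  parity_word G (s ++ b) -> reduced_block (act G s) b -> disjoint_letters s b ->
  parity_word G s /\
  forall L, uniq L -> {subset b <= L} -> pivots L (act G s) b (act G (s ++ b)).
Proof.
have catI2 (a c : seq V) x y : a ++ [:: x] = c ++ [:: y] -> a = c /\ x = y.
  by rewrite !cats1 => /rcons_inj[].
have disjP (c : seq V) x : x \in c -> s = c -> x \in b -> disjoint_letters s b -> False.
  by move=> xc -> xb /negP[]; apply/hasP; exists x.
have -> : act G (s ++ b) = act (act G s) b by rewrite /act foldl_cat.
move=> pw rb dsb; case: rb => [[u eb]|[u [v [uv eb]]]].
  case: (parity_word_inv pw) => [|[s' [w [e ps wu]]]|[s' [p [q [e _ _ _ _]]]]].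
  - by rewrite eb; case: (s).
  - move: e; rewrite eb => /catI2[? ?]; subst s' w; split=> // L uL bL.
    by apply: pivots_white => //; apply: bL; rewrite mem_head.
  (* A black rule would end the word in [p], [q], [p], putting [p = u] already in [s], against
     disjointness. *)
  - have [es eu] : s = s' ++ [:: p; q] /\ u = p.
      by apply: catI2; rewrite -catA /= -e eb.
    by case: (disjP _ p _ es _ dsb); rewrite ?eb ?eu !(mem_cat, inE) eqxx ?orbT.
have sE : s ++ b = (s ++ [:: u; v]) ++ [:: u] by rewrite eb -catA.
case: (parity_word_inv pw) => [|[s1 [w [e1 p1 w1]]]|[s' [p [q [e ps pq bp bq]]]]].
- by rewrite eb; case: (s).
- have [? ?] := catI2 _ _ _ _ (etrans (esym sE) e1); subst s1 w.
  case: (parity_word_inv p1) => [|[s2 [w [e2 p2 w2]]]|[s' [p [q [e _ _ _ _]]]]].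
  + by case: (s).
  + have [? ?] : s ++ [:: u] = s2 /\ v = w by apply: catI2; rewrite -e2 -catA.
    subst s2 w.
    case: (parity_word_inv p2) => [|[s3 [w [e3 p3 w3]]]|[s' [p [q [e _ _ _ _]]]]].
    * by case: (s).
    * have [? ?] := catI2 _ _ _ _ e3; subst s3 w.
      move: w2 w1; rewrite /act !foldl_cat -/(act G s) /= => w2 w1; exfalso.
      (* Acting with [u] keeps its own colour and the edge [uv], as [u] is not its own neighbour;
         then white [v] flips [u]. *)
      move: w1; rewrite {1}/loc_white /= w2 /loc_white /loc_edge w3.
      by rewrite !edge_irr edge_sym uv !andbF.
    * have [es eu] : s = s' ++ [:: p; q] /\ u = p by apply: catI2; rewrite e -catA.
      by case: (disjP _ p _ es _ dsb); rewrite ?eb ?eu !(mem_cat, inE) eqxx ?orbT.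
  + have [es ev] : s ++ [:: u] = (s' ++ [:: p]) ++ [:: q] /\ v = p.
      by apply: catI2; rewrite -!catA.
    have [{}es eu] := catI2 _ _ _ _ es.
    by case: (disjP _ p _ es _ dsb); rewrite ?eb ?ev !(mem_cat, inE) eqxx ?orbT.
(* Comparing letters from the end identifies the last rule with the block. *)
- have /catI2[e' eu] : (s ++ [:: u; v]) ++ [:: u] = (s' ++ [:: p; q]) ++ [:: p].
    by rewrite -sE e -catA.
  have /catI2[/catI2[? ?] ?] : (s ++ [:: u]) ++ [:: v] = (s' ++ [:: p]) ++ [:: q].
    by rewrite -!catA.
  subst s' p q; split=> // L uL bL; rewrite eb.
  by apply: pivots_black_edge => //; apply: bL; rewrite eb !inE eqxx ?orbT.
Qed.

(** Blocks are peeled off from the right, where parity words grow; what remains is again a reduced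
    parity word, and disjoint letters let the pivots compose. *)
Lemma pivots_reduced_parity (V : eqType) (G : bgraph V) (s : seq V) :
  parity_word G s -> reduced G s ->
  forall L, uniq L -> {subset s <= L} -> pivots L G s (act G s).
Proof.
move=> ps [bs [es dbs rbs]] L uL; rewrite {s}es in ps *.
elim/last_ind: bs dbs rbs ps => [|bs b IH]; first by move=> *; exact: pivots_nil.
rewrite pairwise_rcons flatten_rcons => /andP[/allP dbsb dbs] rbs pw sL.
have disj : disjoint_letters (flatten bs) b.
  apply/hasPn => x xb; apply/negP => /flattenP[c cbs xc].
  by have /hasPn/(_ x xb)/negP[] := dbsb c cbs.
have rb : reduced_block (act G (flatten bs)) b.
  have := rbs (size bs); rewrite size_rcons nth_rcons ltnn eqxx => /(_ (ltnSn _)).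
  by rewrite -cats1 take_size_cat.
have [ps pb] := parity_word_last_block pw rb disj.
apply: pivots_cat disj _ (pb L uL _); last first.
  by move=> z zb; apply: sL; rewrite mem_cat zb orbT.
apply: IH => // [i lti|z zs]; last by apply: sL; rewrite mem_cat zs.
have := rbs i; rewrite size_rcons ltnS nth_rcons lti => /(_ (ltnW lti)).
by rewrite -cats1 takel_cat // ltnW.
Qed.

Theorem theorem1p6p3 (V : eqType) (G : bgraph V) (s t : seq V)
    (hs : parity_word G s) (ht : parity_word G t)
    (rs : reduced G s) (rt : reduced G t)
    (hst : s =i t) :
  act G s = act G t.
Proof.
exact: pivots_unique hst (pivots_reduced_parity hs rs) (pivots_reduced_parity ht rt).
Qed.
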